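(* Let $G$ be a $\Gamma$-semigroup and let $a,c\in G$ be such that $(a,c)\in\mathcal{R}\circ\mathcal{L}$. Let $b\in G$ be an element with $(a,b)\in\mathcal{R}$ and $(b,c)\in\mathcal{L}$, and let $s,s',t,t'\in G^1$ and $\gamma,\mu,\rho,\zeta\in\Gamma$ be such that $$a\gamma s=b,\quad b\mu s'=a,\quad t\rho b=c,\quad t'\zeta c=b.$$ Consider the mappings $$\sigma:(a)_{\mathcal{R}}\cap(a)_{\mathcal{L}}\to(c)_{\mathcal{R}}\cap(c)_{\mathcal{L}},\quad x\mapsto t\rho x\gamma s,$$ $$\sigma':(c)_{\mathcal{R}}\cap(c)_{\mathcal{L}}\to(a)_{\mathcal{R}}\cap(a)_{\mathcal{L}},\quad x\mapsto t'\zeta x\mu s'.$$ Then $\sigma$ and $\sigma'$ are well-defined mappings between the indicated sets and are mutually inverse; $\sigma$ is a one-to-one mapping of $(a)_{\mathcal{R}}\cap(a)_{\mathcal{L}}$ onto $(c)_{\mathcal{R}}\cap(c)_{\mathcal{L}}$, and $\sigma'$ is a one-to-one mapping of $(c)_{\mathcal{R}}\cap(c)_{\mathcal{L}}$ onto $(a)_{\mathcal{R}}\cap(a)_{\mathcal{L}}$.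
   Context: Let $G$ and $\Gamma$ be nonempty sets. $G$ is a $\Gamma$-semigroup if $\Gamma$ acts as a set of binary operations on $G$, i.e. there is a well-defined map $G\times\Gamma\times G\to G$, $(a,\gamma,b)\mapsto a\gamma b$, such that $(a\gamma b)\mu c=a\gamma(b\mu c)$ for all $a,b,c\in G$ and all $\gamma,\mu\in\Gamma$. $G^1=G\cup\{1\}$, where $1$ is a symbol adjoined to $G$ ($1\notin G$), with the convention $a\gamma 1=a$ and $1\gamma a=a$ for every $a\in G$ and every $\gamma\in\Gamma$. For $x\in G$, $t,s\in G^1$ and $\rho,\gamma\in\Gamma$, the expression $t\rho x\gamma s$ denotes the element $(t\rho x)\gamma s=t\rho(x\gamma s)$ of $G$. Green's relations on $G$ are the equivalence relations $$\mathcal{R}=\{(a,b)\in G\times G \mid a=b\ \text{or}\ \exists\, x,y\in G,\ \gamma,\mu\in\Gamma:\ a\gamma x=b,\ b\mu y=a\},$$ $$\mathcal{L}=\{(a,b)\in G\times G \mid a=b\ \text{or}\ \exists\, x,y\in G,\ \gamma,\mu\in\Gamma:\ x\gamma a=b,\ y\mu b=a\}.$$ Equivalently, one may drop the alternative ''$a=b$'' and let $x,y$ range over $G^1$. For $a\in G$, $(a)_{\mathcal{R}}$ and $(a)_{\mathcal{L}}$ denote the $\mathcal{R}$-class and the $\mathcal{L}$-class of $G$ containing $a$. The relation $\mathcal{R}\circ\mathcal{L}$ on $G$ is $$\mathcal{R}\circ\mathcal{L}=\{(a,c)\mid \exists\, b\in G:\ (a,b)\in\mathcal{R}\ \text{and}\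 (b,c)\in\mathcal{L}\}.$$ *)

(* Defs.v *)
From mathcomp Require Import all_boot all_classical.

Set Implicit Arguments.
Unset Strict Implicit.
Unset Printing Implicit Defensive.

Local Open Scope classical_set_scope.

Record gammaSemigroup (Gamma : Type) := GammaSemigroup {
  gs_sort :> Type;
  gs_inhabited : inhabited gs_sort;
  gs_ops_inhabited : inhabited Gamma;
  gs_mul : gs_sort -> Gamma -> gs_sort -> gs_sort;
  gs_mulA : forall (a b c : gs_sort) (gamma mu : Gamma),
    gs_mul (gs_mul a gamma b) mu c = gs_mul a gamma (gs_mul b mu c)
}.

(* [option G] is G^1, with [None] the adjoined symbol 1. Only products having
   at least one factor in G are defined, and these lie in G: [gs_mulr] allows
   the right factor to be 1, [gs_mull] the left one. *)
Definition gs_mulr (Gamma : Type) (G : gammaSemigroup Gamma)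
    (a : G) (gamma : Gamma) (s : option G) : G :=
  if s is Some y then gs_mul a gamma y else a.

Definition gs_mull (Gamma : Type) (G : gammaSemigroup Gamma)
    (t : option G) (gamma : Gamma) (a : G) : G :=
  if t is Some y then gs_mul y gamma a else a.

(* By this lemma t rho x gamma s needs no parentheses; [gs_mullr] fixes the
   bracketing (t rho x) gamma s. *)
Lemma gs_mullrA (Gamma : Type) (G : gammaSemigroup Gamma)
    (t s : option G) (rho gamma : Gamma) (x : G) :
  gs_mulr (gs_mull t rho x) gamma s = gs_mull t rho (gs_mulr x gamma s).
Proof. by case: t s => [t|] [s|] //=; apply: gs_mulA. Qed.

Definition gs_mullr (Gamma : Type) (G : gammaSemigroup Gamma)
    (t : option G) (rho : Gamma) (gamma : Gamma) (s : option G) (x : G) : G :=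
  gs_mulr (gs_mull t rho x) gamma s.

Definition greenR (Gamma : Type) (G : gammaSemigroup Gamma) : set (G * G) :=
  [set p : G * G | p.1 = p.2 \/
     exists (x y : G) (gamma mu : Gamma),
       gs_mul p.1 gamma x = p.2 /\ gs_mul p.2 mu y = p.1].

Definition greenL (Gamma : Type) (G : gammaSemigroup Gamma) : set (G * G) :=
  [set p : G * G | p.1 = p.2 \/
     exists (x y : G) (gamma mu : Gamma),
       gs_mul x gamma p.1 = p.2 /\ gs_mul y mu p.2 = p.1].

Definition greenRL (Gamma : Type) (G : gammaSemigroup Gamma) : set (G * G) :=
  [set p : G * G | exists b : G, greenR (p.1, b) /\ greenL (b, p.2)].

Definition classR (Gamma : Type) (G : gammaSemigroup Gamma) (a : G) : set G :=
  [set x | greenR (a, x)].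

Definition classL (Gamma : Type) (G : gammaSemigroup Gamma) (a : G) : set G :=
  [set x | greenL (a, x)].

(* Main.v *)
Require Import Defs.
From mathcomp Require Import all_boot all_classical.

Set Implicit Arguments.
Unset Strict Implicit.
Unset Printing Implicit Defensive.

Local Open Scope classical_set_scope.

(** Green's lemma: if a s = b and b s' = a, then right translations by s and s'
    are mutually inverse between the H-classes of a and b, because x = u a gives
    x s s' = u b s' = u a = x.  Dually for left translations by t, t' between
    the H-classes of b and c.  The maps sigma, sigma' are the composites, the
    left and right translations commuting by associativity. *)

Section Green.
Variables (Gamma : Type) (G : gammaSemigroup Gamma).
Implicit Types (a b c x y : G) (s t : option G) (gamma mu rho zeta : Gamma).

(** Makes transitivity of [greenR] uniform over $G^1$. Two proper factors merge into [gs_mul y mu z]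
    by associativity; if one factor is 1, the operation of the other one is kept. *)
Lemma gs_mulr_comp gamma s mu s' : exists delta u, forall a,
  gs_mulr (gs_mulr a gamma s) mu s' = gs_mulr a delta u.
Proof.
case: s s' => [y|] [z|] /=; last by exists gamma, None.
- by exists gamma, (Some (gs_mul y mu z)) => a /=; rewrite gs_mulA.
- by exists gamma, (Some y).
- by exists mu, (Some z).
Qed.

Lemma gs_mull_comp rho t zeta t' : exists delta u, forall a,
  gs_mull t' zeta (gs_mull t rho a) = gs_mull u delta a.
Proof.
case: t t' => [y|] [z|] /=; last by exists rho, None.
- by exists rho, (Some (gs_mul z zeta y)) => a /=; rewrite gs_mulA.
- by exists rho, (Some y).
- by exists zeta, (Some z).
Qed.

(** The alternative [a = b] corresponds to both multipliers being 1, with an operation supplied by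
    the nonemptiness of [Gamma]. Conversely, a single multiplier equal to 1 already forces
    [a = b]. *)
Lemma greenRP a b : greenR (a, b) <-> exists s s' gamma mu,
  gs_mulr a gamma s = b /\ gs_mulr b mu s' = a.
Proof.
split=> [[/= <-|[x [y [gamma [mu h]]]]]|].
- by case: (gs_ops_inhabited G) => gamma; exists None, None, gamma, gamma.
- by exists (Some x), (Some y), gamma, mu.
- move=> [[x|] [[y|] [gamma [mu [h h']]]]]; try by left.
  by right; exists x, y, gamma, mu.
Qed.

Lemma greenLP a b : greenL (a, b) <-> exists t t' rho zeta,
  gs_mull t rho a = b /\ gs_mull t' zeta b = a.
Proof.
split=> [[/= <-|[x [y [rho [zeta h]]]]]|].
- by case: (gs_ops_inhabited G) => rho; exists None, None, rho, rho.
- by exists (Some x), (Some y), rho, zeta.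
- move=> [[x|] [[y|] [rho [zeta [h h']]]]]; try by left.
  by right; exists x, y, rho, zeta.
Qed.

Lemma greenR_trans a b c : greenR (a, b) -> greenR (b, c) -> greenR (a, c).
Proof.
move=> /greenRP[s [s' [g [m [<- ea]]]]] /greenRP[u [u' [h [n [<- eb]]]]].
have [d [v ev]] := gs_mulr_comp g s h u.
have [d' [v' ev']] := gs_mulr_comp n u' m s'.
by apply/greenRP; exists v, v', d, d'; rewrite -ev -ev' eb ea.
Qed.

Lemma greenL_trans a b c : greenL (a, b) -> greenL (b, c) -> greenL (a, c).
Proof.
move=> /greenLP[s [s' [g [m [<- ea]]]]] /greenLP[u [u' [h [n [<- eb]]]]].
have [d [v ev]] := gs_mull_comp g s h u.
have [d' [v' ev']] := gs_mull_comp n u' m s'.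
by apply/greenLP; exists v, v', d, d'; rewrite -ev -ev' eb ea.
Qed.

(** Left translations commute with right ones, so the multipliers relating [a] and [b] also relate
    their translates. *)
Lemma greenR_mull t rho a b :
  greenR (a, b) -> greenR (gs_mull t rho a, gs_mull t rho b).
Proof.
move=> /greenRP[s [s' [g [m [ea eb]]]]]; apply/greenRP; exists s, s', g, m.
by rewrite !gs_mullrA ea eb.
Qed.

Lemma greenL_mulr s gamma a b :
  greenL (a, b) -> greenL (gs_mulr a gamma s, gs_mulr b gamma s).
Proof.
move=> /greenLP[t [t' [g [m [ea eb]]]]]; apply/greenLP; exists t, t', g, m.
by rewrite -!gs_mullrA ea eb.
Qed.

Lemma green_mulr a b s s' gamma mu x :
  gs_mulr a gamma s = b -> gs_mulr b mu s' = a ->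
  (classR a `&` classL a) x ->
  (classR b `&` classL b) (gs_mulr x gamma s) /\
  gs_mulr (gs_mulr x gamma s) mu s' = x.
Proof.
move=> ab ba [aRx aLx].
have xK : gs_mulr (gs_mulr x gamma s) mu s' = x.
  by have /greenLP[t [_ [rho [_ [<- _]]]]] := aLx; rewrite !gs_mullrA ab ba.
split=> //; split; last by rewrite -ab; apply: greenL_mulr.
(* The chain is b R a R x R xs; its last link is witnessed by [s] and [s'] thanks to [xK]. *)
apply: (@greenR_trans _ a); first by apply/greenRP; exists s', s, mu, gamma.
by apply: greenR_trans aRx _; apply/greenRP; exists s, s', gamma, mu.
Qed.

Lemma green_mull b c t t' rho zeta x :
  gs_mull t rho b = c -> gs_mull t' zeta c = b ->
  (classR b `&` classL b) x ->
  (classR c `&` classL c) (gs_mull t rho x) /\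
  gs_mull t' zeta (gs_mull t rho x) = x.
Proof.
move=> bc cb [bRx bLx].
have xK : gs_mull t' zeta (gs_mull t rho x) = x.
  (* Since x R b, x is a right multiple of b, and the left translations act on the factor b
     alone. *)
  by have /greenRP[s [_ [gamma [_ [<- _]]]]] := bRx; rewrite -!gs_mullrA bc cb.
split=> //; split; first by rewrite -bc; apply: greenR_mull.
apply: (@greenL_trans _ b); first by apply/greenLP; exists t', t, zeta, rho.
by apply: greenL_trans bLx _; apply/greenLP; exists t, t', rho, zeta.
Qed.

End Green.

Lemma set_bij_cancel (T U : Type) (A : set T) (B : set U) (f : T -> U)
    (g : U -> T) :
  set_fun A B f -> set_fun B A g -> {in A, cancel f g} -> {in B, cancel g f} ->
  set_bij A B f.
Proof.
move=> fAB gBA fK gK; split=> //; first exact: can_in_inj fK.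
by move=> y By; exists (g y); [apply: gBA | apply: gK; rewrite inE].
Qed.

Theorem mainTheorem1 (Gamma : Type) (G : gammaSemigroup Gamma) (a c : G)
    (hac : greenRL (a, c))
    (b : G) (hab : greenR (a, b)) (hbc : greenL (b, c))
    (s s' t t' : option G) (gamma mu rho zeta : Gamma)
    (hs : gs_mulr a gamma s = b) (hs' : gs_mulr b mu s' = a)
    (ht : gs_mull t rho b = c) (ht' : gs_mull t' zeta c = b) :
  let A := classR a `&` classL a in
  let C := classR c `&` classL c in
  let sigma := fun x : G => gs_mullr t rho gamma s x in
  let sigma' := fun x : G => gs_mullr t' zeta mu s' x in
  (set_fun A C sigma /\ set_fun C A sigma') /\
  ({in A, cancel sigma sigma'} /\ {in C, cancel sigma' sigma}) /\
  (set_bij A C sigma /\ set_bij C A sigma').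
Proof.
move=> A C sigma sigma'.
have sigmaP x : A x -> C (sigma x) /\ sigma' (sigma x) = x.
  (* Factor through the H-class of [b]: first [s] carries x there, then [t] carries the result to
     the H-class of [c]. *)
  move=> Ax; have [Bxs xsK] := green_mulr hs hs' Ax.
  have [Cx txK] := green_mull ht ht' Bxs.
  by rewrite /sigma' /sigma /gs_mullr gs_mullrA txK.
have sigma'P x : C x -> A (sigma' x) /\ sigma (sigma' x) = x.
  move=> Cx; have [Btx txK] := green_mull ht' ht Cx.
  have [Ax xsK] := green_mulr hs' hs Btx.
  (* Only the outer product is rebracketed: the inner one already has the form that [xsK]
     cancels. *)
  by rewrite /sigma /sigma' /gs_mullr (gs_mullrA t) xsK.
have funA : set_fun A C sigma by move=> x /sigmaP[].
have funC : set_fun C A sigma' by move=> x /sigma'P[].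
have sigmaK : {in A, cancel sigma sigma'} by move=> x /set_mem/sigmaP[].
have sigma'K : {in C, cancel sigma' sigma} by move=> x /set_mem/sigma'P[].
by split=> //; split=> //; split; [apply: set_bij_cancel sigmaK sigma'K
                                  | apply: set_bij_cancel sigma'K sigmaK].
Qed.
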